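(* Let $P$ and $Q$ be dMTSs over a common alphabet $A$, and let $p\in P$, $q\in Q$. (i) There exist a dMTS $R$ over $A$ and a state $r\in R$ with $r\sqsubseteq_{\mathrm{dMTS}} p$ and $r\sqsubseteq_{\mathrm{dMTS}} q$ if and only if $p\wedge q$ is defined. (ii) If $p\wedge q$ is defined, then for every dMTS $R$ over $A$ and every $r\in R$: $r\sqsubseteq_{\mathrm{dMTS}} p$ and $r\sqsubseteq_{\mathrm{dMTS}} q$ if and only if $r\sqsubseteq_{\mathrm{dMTS}} p\wedge q$.
   Context: A disjunctive Modal Transition System (dMTS) is a tuple $(P,A,\longrightarrow_P,\dashrightarrow_P)$ with $P$ a set of states, $A$ an alphabet not containing the silent action $\tau$, a must-transition relation $\longrightarrow_P\subseteq P\times A\times(2^P\setminus\{\emptyset\})$ and a may-transition relation $\dashrightarrow_P\subseteq P\times(A\cup\{\tau\})\times P$, satisfying syntactic consistency: $p\xrightarrow{a}P'$ (must) implies $p\stackrel{a}{\dashrightarrow}p'$ (may) for all $p'\in P'$. Write $p\xrightarrow{a}$ if $p\xrightarrow{a}P'$ for some $P'$. Weak may-transitions: $p\stackrel{\epsilon}{\Longrightarrow}p'$ iff $p(\stackrel{\tau}{\dashrightarrow})^*p'$; for $\alpha\in A\cup\{\tau\}$, $p\stackrel{\alpha}{\Longrightarrow}p'$ iff there is $p''$ with $p\stackrel{\epsilon}{\Longrightarrow}p''\stackrel{\alpha}{\dashrightarrow}p'$ (so for $\alpha=\tau$ at least one step); $p\stackrel{\alpha}{\Longrightarrow}$ means such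 $p'$ exists, and $\not\stackrel{\alpha}{\Longrightarrow}$ its negation. $\hat\alpha=\epsilon$ if $\alpha=\tau$, else $\hat\alpha=\alpha$. For dMTSs $P,Q$ over $A$, $\mathcal R\subseteq P\times Q$ is an observational modal refinement relation if for all $(p,q)\in\mathcal R$: (i) $q\xrightarrow{a}Q'$ implies there is $P'$ with $p\xrightarrow{a}P'$ and for every $p'\in P'$ some $q'\in Q'$ with $(p',q')\in\mathcal R$; (ii) $p\stackrel{\alpha}{\dashrightarrow}p'$ implies there is $q'$ with $q\stackrel{\hat\alpha}{\Longrightarrow}q'$ and $(p',q')\in\mathcal R$. $p\sqsubseteq_{\mathrm{dMTS}}q$ iff some such relation contains $(p,q)$. Conjunctive product $P\& Q$ of dMTSs $P,Q$ over $A$: state set $P\times Q$, alphabet $A$, with (Must1) $(p,q)\xrightarrow{a}\{(p',q'): p'\in P', q\stackrel{a}{\Longrightarrow}_Qq'\}$ if $p\xrightarrow{a}_PP'$ and $q\stackrel{a}{\Longrightarrow}_Q$; (Must2) $(p,q)\xrightarrow{a}\{(p',q'): p\stackrel{a}{\Longrightarrow}_Pp', q'\in Q'\}$ if $p\stackrel{a}{\Longrightarrow}_P$ and $q\xrightarrow{a}_QQ'$; (May1) $(p,q)\stackrel{\tau}{\dashrightarrow}(p',q)$ if $p\stackrel{\tau}{\Longrightarrow}_Pp'$; (May2) $(p,q)\stackrel{\tau}{\dashrightarrow}(p,q')$ if $q\stackrel{\tau}{\Longrightarrow}_Qq'$; (May3) $(p,q)\stackrel{\alpha}{\dashrightarrow}(p',q')$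 if $p\stackrel{\alpha}{\Longrightarrow}_Pp'$ and $q\stackrel{\alpha}{\Longrightarrow}_Qq'$ ($\alpha\in A\cup\{\tau\}$). The set $F\subseteq P\times Q$ of inconsistent states is the least set with: (F1) $p\xrightarrow{a}_P$ and $q\not\stackrel{a}{\Longrightarrow}_Q$ imply $(p,q)\in F$; (F2) $p\not\stackrel{a}{\Longrightarrow}_P$ and $q\xrightarrow{a}_Q$ imply $(p,q)\in F$; (F3) $(p,q)\xrightarrow{a}R'$ in $P\& Q$ with $R'\subseteq F$ implies $(p,q)\in F$. The conjunction $P\wedge Q$ is obtained from $P\& Q$ by deleting all states in $F$, all may- and must-transitions leaving deleted states, all may-transitions entering deleted states, and deleting deleted states from targets of must-transitions. The state $(p,q)$ of $P\wedge Q$ is written $p\wedge q$; $p\wedge q$ is defined iff $(p,q)\notin F$. *)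

(* Defs.v *)
From Stdlib Require Import Relation_Operators.
From mathcomp Require Import all_boot boolp classical_sets.

Set Implicit Arguments.
Unset Strict Implicit.
Unset Printing Implicit Defensive.

Local Open Scope classical_set_scope.

(* May-labels range over [option A]: [None] is the silent action tau and
   [Some a] the visible action a. *)
Record dMTS (A : Type) := DMTS {
  state :> Type;
  must : state -> A -> set state -> Prop;
  may : state -> option A -> state -> Prop;
  must_neq0 : forall p a P', must p a P' -> P' !=set0;
  must_may : forall p a P', must p a P' ->
    forall p', P' p' -> may p (Some a) p'
}.

Arguments DMTS {A}.
Arguments must {A d}.
Arguments may {A d}.

Definition can_must (A : Type) (P : dMTS A) (p : P) (a : A) : Prop :=
  exists P', must p a P'.

Definition weak_eps (A : Type) (P : dMTS A) : P -> P -> Prop :=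
  clos_refl_trans P (fun p p' => may p None p').

(* No silent steps are allowed after the alpha-step. *)
Definition weak (A : Type) (P : dMTS A) (p : P) (alpha : option A) (p' : P)
    : Prop :=
  exists2 p'', weak_eps p p'' & may p'' alpha p'.

Definition can_weak (A : Type) (P : dMTS A) (p : P) (alpha : option A) : Prop :=
  exists p', weak p alpha p'.

Definition weak_hat (A : Type) (P : dMTS A) (p : P) (alpha : option A) (p' : P)
    : Prop :=
  if alpha is Some a then weak p (Some a) p' else weak_eps p p'.

Definition is_refinement (A : Type) (P Q : dMTS A) (S : P -> Q -> Prop) : Prop :=
  forall p q, S p q ->
    (forall a Q', must q a Q' ->
       exists2 P', must p a P' &
         forall p', P' p' -> exists2 q', Q' q' & S p' q') /\
    (forall alpha p', may p alpha p' ->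
       exists2 q', weak_hat q alpha q' & S p' q').

Definition refines (A : Type) (P Q : dMTS A) (p : P) (q : Q) : Prop :=
  exists2 S : P -> Q -> Prop, is_refinement S & S p q.

Inductive prod_must (A : Type) (P Q : dMTS A) :
    P * Q -> A -> set (P * Q) -> Prop :=
| Must1 p q a P' : must p a P' -> can_weak q (Some a) ->
    prod_must (p, q) a [set x | P' x.1 /\ weak q (Some a) x.2]
| Must2 p q a Q' : can_weak p (Some a) -> must q a Q' ->
    prod_must (p, q) a [set x | weak p (Some a) x.1 /\ Q' x.2].

Inductive prod_may (A : Type) (P Q : dMTS A) :
    P * Q -> option A -> P * Q -> Prop :=
| May1 p q p' : weak p None p' -> prod_may (p, q) None (p', q)
| May2 p q q' : weak q None q' -> prod_may (p, q) None (p, q')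
| May3 p q alpha p' q' : weak p alpha p' -> weak q alpha q' ->
    prod_may (p, q) alpha (p', q').

Lemma may_weak (A : Type) (P : dMTS A) (p : P) alpha p' :
  may p alpha p' -> weak p alpha p'.
Proof. by move=> h; exists p => //; apply: rt_refl. Qed.

Lemma prod_must_neq0 (A : Type) (P Q : dMTS A) (x : P * Q) a X :
  prod_must x a X -> X !=set0.
Proof.
case=> {x a X} p q a T.
- by move=> h [q' hq']; have [p' hp'] := must_neq0 h; exists (p', q').
- by move=> [p' hp'] h; have [q' hq'] := must_neq0 h; exists (p', q').
Qed.

Lemma prod_must_may (A : Type) (P Q : dMTS A) (x : P * Q) a X :
  prod_must x a X -> forall y, X y -> prod_may x (Some a) y.
Proof.
case=> {x a X} p q a T.
- move=> hm _ [p' q'] /= [h1 h2].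
  by apply: May3 => //; apply/may_weak/(must_may hm).
- move=> _ hm [p' q'] /= [h1 h2].
  by apply: May3 => //; apply/may_weak/(must_may hm).
Qed.

Definition conj_prod (A : Type) (P Q : dMTS A) : dMTS A :=
  DMTS (P * Q)%type (@prod_must A P Q) (@prod_may A P Q)
    (@prod_must_neq0 A P Q) (@prod_must_may A P Q).

Inductive inconsistent (A : Type) (P Q : dMTS A) : set (conj_prod P Q) :=
| F1 (p : P) (q : Q) a : can_must p a -> ~ can_weak q (Some a) ->
    inconsistent (p, q)
| F2 (p : P) (q : Q) a : ~ can_weak p (Some a) -> can_must q a ->
    inconsistent (p, q)
| F3 (x : conj_prod P Q) a X : must x a X -> X `<=` @inconsistent A P Q ->
    inconsistent x.

Definition conj_defined (A : Type) (P Q : dMTS A) (p : P) (q : Q) : Prop :=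
  ~ @inconsistent A P Q (p, q).

Definition conj_state (A : Type) (P Q : dMTS A) : Type :=
  {x : conj_prod P Q | ~ inconsistent x}.

Definition conj_must (A : Type) (P Q : dMTS A) (x : conj_state P Q) (a : A)
    (X : set (conj_state P Q)) : Prop :=
  exists2 Y : set (conj_prod P Q), must (sval x) a Y & X = [set y | Y (sval y)].

Definition conj_may (A : Type) (P Q : dMTS A) (x : conj_state P Q)
    (alpha : option A) (y : conj_state P Q) : Prop :=
  may (sval x) alpha (sval y).

Lemma conj_must_neq0 (A : Type) (P Q : dMTS A) (x : conj_state P Q) a X :
  conj_must x a X -> X !=set0.
Proof.
case: x => x hx [Y /= hY ->]; apply: contrapT => hX; apply: hx.
apply: (F3 hY) => y Yy; apply: contrapT => hy; apply: hX.
by exists (exist _ y hy).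
Qed.

Lemma conj_must_may (A : Type) (P Q : dMTS A) (x : conj_state P Q) a X :
  conj_must x a X -> forall y, X y -> conj_may x (Some a) y.
Proof. by move=> [Y hY ->] y /= Yy; apply: (must_may hY). Qed.

Definition conjunction (A : Type) (P Q : dMTS A) : dMTS A :=
  DMTS (conj_state P Q) (@conj_must A P Q) (@conj_may A P Q)
    (@conj_must_neq0 A P Q) (@conj_must_may A P Q).

Definition conj_pair (A : Type) (P Q : dMTS A) (p : P) (q : Q)
    (h : conj_defined p q) : conjunction P Q :=
  exist _ (p, q) h.

(* Main.v *)
From Stdlib Require Import Relation_Operators.
Require Import Defs.
From mathcomp Require Import all_boot boolp classical_sets.

(** If [r] refines both [p] and [q], then a must-transition of [(p, q)] in the
    product is matched by one of [r], whose target is nonempty and consists of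
    common refinements of pairs in the product target. So the pairs having a
    common refinement avoid the least fixed point of (F1)-(F3). The same
    computation shows that "common refinement of both components" is a
    refinement relation towards the conjunction. Conversely, in a consistent
    pair (F1) and (F2) guarantee that each must-transition of a component gives
    one of the pair, so the projections are refinements. *)

Set Implicit Arguments.
Unset Strict Implicit.
Unset Printing Implicit Defensive.

Local Open Scope classical_set_scope.

Section WeakTransitions.
Variables (A : Type) (P : dMTS A).
Implicit Types p : P.

Lemma weak_eps_weak p p' p'' alpha :
  weak_eps p p' -> weak p' alpha p'' -> weak p alpha p''.
Proof. by move=> e [u e' m]; exists u => //; apply: rt_trans e e'. Qed.

Lemma weak_tau_eps p p' : weak p None p' -> weak_eps p p'.
Proof. by case=> u e m; apply: rt_trans e _; apply: rt_step. Qed.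

Lemma weak_epsE p p' : weak_eps p p' -> p = p' \/ weak p None p'.
Proof.
elim=> {p p'} [p p' m|p|p u p' _ IH1 _ IH2].
- by right; apply: may_weak.
- by left.
- case: IH1 => [->//|w1]; right.
  by case: IH2 => [<-//|]; apply/weak_eps_weak/weak_tau_eps.
Qed.

Lemma may_weak_hat p alpha p' : may p alpha p' -> weak_hat p alpha p'.
Proof. by case: alpha => [a|] m; [apply: may_weak | apply: rt_step]. Qed.

End WeakTransitions.

Section Refinement.
Variable A : Type.

(** The union of all refinement relations is again one, so [refines] can be unfolded step by
    step. *)
Lemma refines_refinement (P Q : dMTS A) : is_refinement (@refines A P Q).
Proof.
move=> p q [S HS /HS [Hmust Hmay]]; split.
- move=> a Q' /Hmust [P' mP H]; exists P' => // p' /H [q' Qq' Spq].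
  by exists q' => //; exists S.
- move=> alpha p' /Hmay [q' wq Spq]; exists q' => //; by exists S.
Qed.

Lemma refines_must (P Q : dMTS A) (p : P) (q : Q) a Q' :
  refines p q -> must q a Q' ->
  exists2 P', must p a P' &
    forall p', P' p' -> exists2 q', Q' q' & refines p' q'.
Proof. by move=> /refines_refinement[+ _]; apply. Qed.

Lemma refines_may (P Q : dMTS A) (p : P) (q : Q) alpha p' :
  refines p q -> may p alpha p' ->
  exists2 q', weak_hat q alpha q' & refines p' q'.
Proof. by move=> /refines_refinement[_]; apply. Qed.

Lemma refines_refl (P : dMTS A) (p : P) : refines p p.
Proof.
exists eq => // {}p _ <-; split.
- by move=> a P' m; exists P' => // p' Pp'; exists p'.
- by move=> alpha p' /may_weak_hat w; exists p'.
Qed.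

End Refinement.

Section Conjunction.
Variables (A : Type) (P Q : dMTS A).

(* The principle generated by Rocq has no induction hypothesis for [F3], where
   the recursive occurrence is hidden under [`<=`]. *)
Lemma inconsistent_induction (T : set (conj_prod P Q)) :
  (forall (p : P) (q : Q) a,
     can_must p a -> ~ can_weak q (Some a) -> T (p, q)) ->
  (forall (p : P) (q : Q) a,
     ~ can_weak p (Some a) -> can_must q a -> T (p, q)) ->
  (forall (x : conj_prod P Q) a X, must x a X -> X `<=` T -> T x) ->
  @inconsistent A P Q `<=` T.
Proof.
move=> H1 H2 H3; rewrite /subset; fix IH 2 => x [p q a|p q a|{}x a X mX XF].
- exact: H1.
- exact: H2.
- by apply: (H3 _ _ _ mX) => y /XF; apply: IH.
Qed.

Definition refines_both (R : dMTS A) (r : R) (x : conj_prod P Q) : Prop :=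
  refines r x.1 /\ refines r x.2.

Lemma refines_both_must (R : dMTS A) (r : R) (x : conj_prod P Q) a X :
  refines_both r x -> must x a X ->
  exists2 R', must r a R' &
    forall r', R' r' -> exists2 y, X y & refines_both r' y.
Proof.
move=> + mX; case: mX => {x a X} p q a.
- move=> P' mP _ [/= rp rq]; have [R' mR HR] := refines_must rp mP.
  exists R' => // r' Rr'; have [p' Pp' rp'] := HR r' Rr'.
  (* By syntactic consistency, reaching [r'] is also a visible may-step of [r]; the other component
     answers it by a weak [a]-move, as the target in [Must1] demands. *)
  have [q' wq rq'] := refines_may rq (must_may mR Rr').
  by exists (p', q').
- move=> Q' _ mQ [/= rp rq]; have [R' mR HR] := refines_must rq mQ.
  exists R' => // r' Rr'; have [q' Qq' rq'] := HR r' Rr'.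
  have [p' wp rp'] := refines_may rp (must_may mR Rr').
  by exists (p', q').
Qed.

Lemma refines_both_may (R : dMTS A) (r : R) (x : conj_prod P Q) alpha r' :
  refines_both r x -> may r alpha r' ->
  exists2 y, (may x alpha y \/ alpha = None /\ x = y) & refines_both r' y.
Proof.
case: x => p q [/= rp rq] m.
have [p' wp rp'] := refines_may rp m; have [q' wq rq'] := refines_may rq m.
exists (p', q') => //; case: alpha m wp wq => [a|] m /=.
  by move=> wp wq; left; apply: May3.
(* For [tau], each component idles or really moves. If both idle, the product has no step to offer
   and stays at [x]. *)
move=> /weak_epsE[->|wp] /weak_epsE[->|wq]; first by right.
- by left; apply: May2.
- by left; apply: May1.
- by left; apply: May3.
Qed.

(** A must-target is nonempty and its elements are may-successors, which [s] has to match; this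
    excludes (F1) and (F2). *)
Lemma refines_can_weak (R S : dMTS A) (r : R) (s : S) a :
  refines r s -> can_must r a -> can_weak s (Some a).
Proof.
move=> rs [R' mR]; have [r' Rr'] := must_neq0 mR.
by have [s' ws _] := refines_may rs (must_may mR Rr'); exists s'.
Qed.

Lemma refines_can_must (R S : dMTS A) (r : R) (s : S) a :
  refines r s -> can_must s a -> can_must r a.
Proof. by move=> rs [S' /(refines_must rs)[R' mR _]]; exists R'. Qed.

Lemma refines_both_consistent (R : dMTS A) (r : R) (x : conj_prod P Q) :
  refines_both r x -> ~ inconsistent x.
Proof.
(* The refining state stays universally quantified, since (F3) passes from [r] to one of its
   successors. *)
move=> + Fx; move: x Fx r.
apply: inconsistent_induction => [p q a mp nq|p q a np mq|x a X mX IH] r.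
- move=> [/= rp rq]; apply: nq; apply: (refines_can_weak rq).
  exact: refines_can_must rp mp.
- move=> [/= rp rq]; apply: np; apply: (refines_can_weak rp).
  exact: refines_can_must rq mq.
- move=> rx; have [R' mR HR] := refines_both_must rx mX.
  have [r' Rr'] := must_neq0 mR.
  by have [y Xy] := HR r' Rr'; apply: IH.
Qed.

Lemma refines_both_conjunction (R : dMTS A) (r : R) (x : conjunction P Q) :
  refines_both r (sval x) -> refines r x.
Proof.
move=> rx; exists (fun s y => refines_both s (sval y)) => // {rx} s y sy.
split.
- move=> a X [Y mY ->]; have [R' mR HR] := refines_both_must sy mY.
  exists R' => // s' /HR[z Yz sz].
  by exists (exist _ z (refines_both_consistent sz)).
- move=> alpha s' m; have [z yz sz] := refines_both_may sy m.
  exists (exist _ z (refines_both_consistent sz)) => //.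
  case: yz => [yz|[-> yz]]; first exact: may_weak_hat.
  (* When the product idles, [z] carries a new consistency proof; proof irrelevance identifies it
     with [y]. *)
  rewrite (_ : exist _ z _ = y); first exact: rt_refl.
  by move: y yz {sy} => [y hy] /= yz; apply: eq_exist.
Qed.

(** The hat is needed because a component left idle by [May1] or [May2] contributes the empty
    move. *)
Lemma prod_may_weak_hat (x : conj_prod P Q) alpha y :
  may x alpha y -> weak_hat x.1 alpha y.1 /\ weak_hat x.2 alpha y.2.
Proof.
case=> {x alpha y} p q.
- by move=> p' wp; split; [apply: weak_tau_eps | apply: rt_refl].
- by move=> q' wq; split; [apply: rt_refl | apply: weak_tau_eps].
- by case=> [a|] p' q' wp wq; split=> //=; apply: weak_tau_eps.
Qed.

Lemma conjunction_weak_eps (x y : conjunction P Q) :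
  weak_eps x y ->
  weak_eps (sval x).1 (sval y).1 /\ weak_eps (sval x).2 (sval y).2.
Proof.
elim=> {x y} [x y /prod_may_weak_hat//|x|x u y _ [e1 e2] _ [f1 f2]].
- by split; apply: rt_refl.
- by split; [apply: rt_trans e1 f1 | apply: rt_trans e2 f2].
Qed.

Lemma conjunction_weak_hat (x y : conjunction P Q) alpha :
  weak_hat x alpha y ->
  weak_hat (sval x).1 alpha (sval y).1 /\
  weak_hat (sval x).2 alpha (sval y).2.
Proof.
case: alpha => [a|]; last exact: conjunction_weak_eps.
move=> [u /conjunction_weak_eps[e1 e2] /prod_may_weak_hat[w1 w2]].
by split; [apply: weak_eps_weak e1 w1 | apply: weak_eps_weak e2 w2].
Qed.

(** Consistency of [x] excludes (F1), so the side condition of [Must1] holds; pruning only shrinks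
    the target. *)
Lemma conjunction_must_fst (x : conjunction P Q) a P' :
  must (sval x).1 a P' ->
  exists2 X, must x a X & forall y, X y -> P' (sval y).1.
Proof.
case: x => [[p q] h] /= mP.
have wq : can_weak q (Some a).
  by apply: contrapT => nq; apply: h; apply: (@F1 _ _ _ _ _ a) nq; exists P'.
exists [set y | P' (sval y).1 /\ weak q (Some a) (sval y).2]; last by move=> y [].
by exists [set y | P' y.1 /\ weak q (Some a) y.2] => //; apply: Must1.
Qed.

Lemma conjunction_must_snd (x : conjunction P Q) a Q' :
  must (sval x).2 a Q' ->
  exists2 X, must x a X & forall y, X y -> Q' (sval y).2.
Proof.
case: x => [[p q] h] /= mQ.
have wp : can_weak p (Some a).
  by apply: contrapT => np; apply: h; apply: (@F2 _ _ _ _ _ a) np _; exists Q'.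
exists [set y | weak p (Some a) (sval y).1 /\ Q' (sval y).2]; last by move=> y [].
by exists [set y | weak p (Some a) y.1 /\ Q' y.2] => //; apply: Must2.
Qed.

(** Treats both projections at once: the relation is [refines] followed by the graph of [f]. *)
Lemma refines_conjunction_proj (S R : dMTS A) (f : conjunction P Q -> S)
    (r : R) (x : conjunction P Q) :
  (forall y a S', must (f y) a S' ->
     exists2 X, must y a X & forall z, X z -> S' (f z)) ->
  (forall y alpha z, weak_hat y alpha z -> weak_hat (f y) alpha (f z)) ->
  refines r x -> refines r (f x).
Proof.
move=> fmust fmay rx.
exists (fun t s => exists2 y, refines t y & f y = s); last by exists x.
move=> t _ [y ty <-]; split.
- move=> a S' /fmust[X mX HX]; have [R' mR HR] := refines_must ty mX.
  exists R' => // t' /HR[z Xz tz]; exists (f z); first exact: HX.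
  by exists z.
- move=> alpha t' m; have [z wz tz] := refines_may ty m.
  exists (f z); first exact: fmay.
  by exists z.
Qed.

Lemma refines_conjunctionP (R : dMTS A) (r : R) (x : conjunction P Q) :
  refines_both r (sval x) <-> refines r x.
Proof.
split=> [|rx]; first exact: refines_both_conjunction.
split.
- apply: (refines_conjunction_proj (f := fun y => (sval y).1)) rx.
    exact: conjunction_must_fst.
  by move=> y alpha z /conjunction_weak_hat[].
- apply: (refines_conjunction_proj (f := fun y => (sval y).2)) rx.
    exact: conjunction_must_snd.
  by move=> y alpha z /conjunction_weak_hat[].
Qed.

End Conjunction.

Theorem theorem3p5 (A : Type) (P Q : dMTS A) (p : P) (q : Q) :
  ((exists (R : dMTS A) (r : R), refines r p /\ refines r q)
     <-> conj_defined p q) /\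
  (forall (h : conj_defined p q) (R : dMTS A) (r : R),
     (refines r p /\ refines r q) <-> refines r (conj_pair h)).
Proof.
split; [split=> [[R [r rpq]]|h]|move=> h R r].
- exact: (@refines_both_consistent _ _ _ _ r (p, q)).
- exists (conjunction P Q), (conj_pair h).
  exact: (refines_conjunctionP _ (conj_pair h)).2 (refines_refl _).
- exact: (refines_conjunctionP r (conj_pair h)).
Qed.
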